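(* Let $G$ be a digraph on the vertex set $V=\{v_1,\ldots,v_n\}$ with adjacency matrix $A=[a_{ij}]$ (so $a_{ij}=1$ if $(v_i,v_j)$ is an arc of $G$ and $a_{ij}=0$ otherwise). Define $\alpha_i^+=\sum_{j=1}^n a_{ij}$ and $\alpha_j^-=\sum_{i=1}^n a_{ij}$, so that $d^+(v_i)=\alpha_i^+$ and $d^-(v_i)=\alpha_i^-$. Suppose that the vertices are ordered so that the degree sequence $\alpha=\big((\alpha_1^+,\alpha_1^-),\ldots,(\alpha_n^+,\alpha_n^-)\big)$ of $G$ is in positive lexicographical order. Then the following are equivalent: \begin{enumerate} \item $G$ is the unique labeled realization of the degree sequence $\alpha$. \item There are no 2-switches and no induced directed 3-cycles in $G$. \item For every triple of distinct indices $i$, $j$, $k$ with $i<j$, if $a_{jk}=1$, then $a_{ik}=1$. \item For every $k$ with $1\le k\le n$, \[ \sum_{i=1}^k\min(\alpha_i^-,k-1)+\sum_{i=k+1}^n\min(\alpha_i^-,k)=\sum_{i=1}^k\alpha_i^+. \] \end{enumerate}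
   Context: A digraph $G=(V,E)$ is finite and loopless, and $E$ is a set of ordered pairs of distinct vertices, called arcs (both $(v,w)$ and $(w,v)$ may be present; adjacency matrices are zero-one matrices with zero diagonal). The out-degree $d^+(v)$ is the number of arcs $(v,w)$, and the in-degree $d^-(v)$ is the number of arcs $(w,v)$. A realization of a sequence of integer pairs $\alpha=\big((\alpha_1^+,\alpha_1^-),\ldots,(\alpha_n^+,\alpha_n^-)\big)$ is a digraph on $V=\{v_1,\ldots,v_n\}$ with $d^+(v_i)=\alpha_i^+$ and $d^-(v_i)=\alpha_i^-$ for all $i$. $G$ is the unique labeled realization of $\alpha$ if it is the only digraph on the labeled vertex set $\{v_1,\ldots,v_n\}$ that is a realization of $\alpha$ (digraphs are compared by equality of arc sets, not up to isomorphism). The sequence $\alpha$ is in positive lexicographical order if, for every $1\le i<n$, $\alpha_i^+\ge\alpha_{i+1}^+$, and moreover $\alpha_i^-\ge\alpha_{i+1}^-$ whenever $\alpha_i^+=\alpha_{i+1}^+$. A 2-switch in $G$ is a set of four distinct vertices $w,x,y,z$ such that $(w,x)$ and $(y,z)$ are arcs of $G$ and $(w,z)$ and $(y,x)$ are not arcs of $G$. An induced directed 3-cycle in $G$ is a set of three distinct vertices $x,y,z$ such that $(x,y),(y,z),(z,x)$ are arcs of $G$ and there are no other arcs of $G$ among these three vertices. *)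

(* Defs.v *)
From HB Require Import structures.
From mathcomp Require Import all_boot all_order all_algebra.

Set Implicit Arguments.
Unset Strict Implicit.
Unset Printing Implicit Defensive.

(* The vertex v_(i+1) is represented by i : 'I_n. *)
Record digraph (n : nat) := Digraph {
  arcs : {set 'I_n * 'I_n};
  arcs_loopless : forall v, (v, v) \notin arcs
}.

Section DigraphDefs.
Variable n : nat.
Implicit Types (G H : digraph n) (alpha : 'I_n -> nat * nat).

Definition arc G : rel 'I_n := fun v w => (v, w) \in arcs G.

Definition outdeg G (v : 'I_n) : nat := #|[set w | arc G v w]|.
Definition indeg G (v : 'I_n) : nat := #|[set w | arc G w v]|.

Definition adjmx G : 'M[nat]_n := \matrix_(i, j) nat_of_bool (arc G i j).

Definition degree_seq G : 'I_n -> nat * nat :=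
  fun i => (\sum_j adjmx G i j, \sum_j adjmx G j i).

(* In a pair of alpha, the first component is the out-degree. *)
Definition realization alpha G : Prop :=
  forall v, outdeg G v = (alpha v).1 /\ indeg G v = (alpha v).2.

Definition unique_labeled_realization alpha G : Prop :=
  realization alpha G /\ forall H, realization alpha H -> arcs H = arcs G.

Definition positive_lex alpha : Prop :=
  forall i j : 'I_n, j = i.+1 :> nat ->
    (alpha j).1 <= (alpha i).1 /\
    ((alpha i).1 = (alpha j).1 -> (alpha j).2 <= (alpha i).2).

Definition two_switch G (w x y z : 'I_n) : Prop :=
  [/\ uniq [:: w; x; y; z], arc G w x, arc G y z, ~~ arc G w z & ~~ arc G y x].

Definition induced_3cycle G (x y z : 'I_n) : Prop :=
  [/\ uniq [:: x; y; z],
      [/\ arc G x y, arc G y z & arc G z x] &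
      [/\ ~~ arc G y x, ~~ arc G z y & ~~ arc G x z]].

Lemma realization_degree_seq G : realization (degree_seq G) G.
Proof.
by move=> v; split; rewrite /= /outdeg /indeg -sum1dep_card big_mkcond /=;
  apply: eq_bigr => w _; rewrite mxE; case: arc.
Qed.

End DigraphDefs.

(* Main.v *)
(** By the ordering of the degrees, a violation of (3) produces a 2-switch or an
    induced 3-cycle. Condition (3) says that the in-neighbours of each vertex v
    form an initial segment of V \ {v}, and (4) expresses the same thing by
    counting: in every digraph, the first k vertices contain at most
    min(d^-(v), |{v_1, ..., v_k} \ {v}|) in-neighbours of v, and (4) forces
    equality for all v and k. These counts determine the arcs, so any two
    realizations agree. *)
Require Import Defs.
From HB Require Import structures.
From mathcomp Require Import all_boot all_order all_algebra.
From mathcomp Require Import all_fingroup zify.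

Set Implicit Arguments.
Unset Strict Implicit.
Unset Printing Implicit Defensive.

(* [path.arc] would otherwise take precedence. *)
Local Notation arc := Defs.arc.

(** * Uniqueness excludes 2-switches and induced 3-cycles *)

Section DegreePreservingMoves.
Variable n : nat.
Implicit Types G H : digraph n.

Lemma arcxx G v : arc G v v = false.
Proof. exact/negbTE/arcs_loopless. Qed.

Lemma degree_seqE G v : degree_seq G v = (outdeg G v, indeg G v).
Proof.
by have [-> ->] := realization_degree_seq G v; case: (degree_seq G v).
Qed.

Lemma arcs_eq G H : (forall v w, arc H v w = arc G v w) -> arcs H = arcs G.
Proof. by move=> eqHG; apply/setP => -[v w]; apply: eqHG. Qed.

(* Both switches and cycle reversals permute the out-neighbourhood of each
   vertex (by [s]) and, equivalently, its in-neighbourhood (by [t]). *)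
Lemma unique_realization_twist G (s t : 'I_n -> 'I_n -> 'I_n) :
    unique_labeled_realization (degree_seq G) G ->
    (forall v, injective (s v)) -> (forall v, injective (t v)) ->
    (forall v w, arc G v (s v w) = arc G (t w v) w) ->
    (forall v, s v v = v) ->
  forall v w, arc G v (s v w) = arc G v w.
Proof.
move=> [_ uniqG] s_inj t_inj st s_id.
have loopless v : (v, v) \notin [set p | arc G p.1 (s p.1 p.2)].
  by rewrite inE /= s_id arcxx.
pose H := Digraph loopless.
have arcH v w : arc H v w = arc G v (s v w) by rewrite /arc inE.
(* Row [v] of the matrix of [H] is that of [G] permuted by [s v], and by [st] column [v] is permuted
   by [t v], so all degrees survive. *)
have eqHG : arcs H = arcs G.
  apply: uniqG => v; rewrite degree_seqE /=; split.
    rewrite /outdeg -[RHS](card_preimset _ (s_inj v)).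
    by apply: eq_card => w; rewrite !inE arcH.
  rewrite /indeg -[RHS](card_preimset _ (t_inj v)).
  by apply: eq_card => w; rewrite !inE arcH st.
by move=> v w; rewrite -arcH /arc eqHG.
Qed.

Lemma unique_realization_no_2switch G w x y z :
  unique_labeled_realization (degree_seq G) G -> ~ two_switch G w x y z.
Proof.
move=> uG [] /=; rewrite !inE !negb_or => /and4P[/and3P[wx wy wz] /andP[xy xz] yz _].
move=> Gwx Gyz /negbTE Gwz /negbTE Gyx.
have [xw zw yw] : [/\ x != w, z != w & y != w] by split; rewrite eq_sym.
have [yx zx zy] : [/\ y != x, z != x & z != y] by split; rewrite eq_sym.
(* The switch exchanges columns [x], [z] within rows [w], [y]; this is the same as exchanging rows
   [w], [y] within columns [x], [z]. *)
pose s v := if (v == w) || (v == y) then tperm x z else 1%g.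
pose t v := if (v == x) || (v == z) then tperm w y else 1%g.
have sw : s w = tperm x z by rewrite /s eqxx.
have sy : s y = tperm x z by rewrite /s eqxx orbT.
have sD v : v != w -> v != y -> s v = 1%g by rewrite /s => /negbTE-> /negbTE->.
have tx : t x = tperm w y by rewrite /t eqxx.
have tz : t z = tperm w y by rewrite /t eqxx orbT.
have tD v : v != x -> v != z -> t v = 1%g by rewrite /t => /negbTE-> /negbTE->.
suff: arc G w (s w x) = arc G w x by rewrite sw tpermL Gwx Gwz.
apply: (unique_realization_twist (s := s) (t := t)) => // [v|v|v u|v];
  try exact: perm_inj; last first.
  have [->|vw] := eqVneq v w; first by rewrite sw tpermD.
  by have [->|vy] := eqVneq v y; rewrite ?sy ?tpermD ?sD ?perm1.
have [->|vw] := eqVneq v w; [|have [->|vy] := eqVneq v y];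
(have [->|ux] := eqVneq u x; [|have [->|uz] := eqVneq u z]);
by rewrite ?sw ?sy ?tx ?tz ?(sD v) ?(tD u) ?perm1 ?tpermL ?tpermR ?Gwx ?Gyz
           ?Gwz ?Gyx // tpermD // eq_sym.
Qed.

Lemma unique_realization_no_3cycle G x y z :
  unique_labeled_realization (degree_seq G) G -> ~ induced_3cycle G x y z.
Proof.
move=> uG [] /=; rewrite !inE !negb_or => /and3P[/andP[xy xz] yz _].
move=> [Gxy Gyz Gzx] [/negbTE Gyx /negbTE Gzy /negbTE Gxz].
have [yx zx zy] : [/\ y != x, z != x & z != y] by split; rewrite eq_sym.
(* Reversing the cycle swaps, for each of its vertices, the other two. The same permutations serve
   rows and columns. *)
pose s v := if v == x then tperm y z else if v == y then tperm z x
            else if v == z then tperm x y else 1%g.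
have sx : s x = tperm y z by rewrite /s eqxx.
have sy : s y = tperm z x by rewrite /s eqxx (negbTE yx).
have sz : s z = tperm x y by rewrite /s eqxx (negbTE zx) (negbTE zy).
have sD v : v != x -> v != y -> v != z -> s v = 1%g.
  by rewrite /s => /negbTE-> /negbTE-> /negbTE->.
suff: arc G x (s x y) = arc G x y by rewrite sx tpermL Gxz Gxy.
apply: (unique_realization_twist (s := s) (t := s)) => // [v|v|v u|v];
  try exact: perm_inj; last first.
  have [->|vx] := eqVneq v x; first by rewrite sx tpermD.
  have [->|vy] := eqVneq v y; first by rewrite sy tpermD.
  have [->|vz] := eqVneq v z; first by rewrite sz tpermD.
  by rewrite sD ?perm1.
have [->|vx] := eqVneq v x; [|have [->|vy] := eqVneq v y; [|have [->|vz] := eqVneq v z]];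
(have [->|ux] := eqVneq u x; [|have [->|uy] := eqVneq u y; [|have [->|uz] := eqVneq u z]]);
by rewrite ?sx ?sy ?sz ?(sD v) ?(sD u) ?perm1 ?tpermL ?tpermR //
           ?(tpermD, arcxx) ?Gxy ?Gyz ?Gzx ?Gyx ?Gzy ?Gxz // eq_sym.
Qed.

End DegreePreservingMoves.

(** * From the degree order to monotone columns *)

Lemma positive_lex_lt (n : nat) (alpha : 'I_n -> nat * nat) (i j : 'I_n) :
    positive_lex alpha -> i < j ->
  (alpha j).1 <= (alpha i).1 /\
  ((alpha i).1 = (alpha j).1 -> (alpha j).2 <= (alpha i).2).
Proof.
move=> lex; case: j => j; elim: j => [//|j IHj] ltjn /=; rewrite ltnS => leij.
have ltj : j < n := ltnW ltjn.
have [le1 le2] := lex (Ordinal ltj) (Ordinal ltjn) erefl.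
move: leij; rewrite leq_eqVlt => /orP[/eqP eqij|/(IHj ltj)[le1' le2']].
  by have -> : i = Ordinal ltj by apply: val_inj.
split=> [|eq1]; first exact: leq_trans le1'.
(* The intermediate out-degree is squeezed between two equal ones. *)
have eq1' : (alpha i).1 = (alpha (Ordinal ltj)).1 by lia.
by apply: leq_trans (le2' eq1'); apply: le2; lia.
Qed.

Lemma switch_free_column_monotone (n : nat) (G : digraph n) (i j k : 'I_n) :
    positive_lex (degree_seq G) ->
    (forall w x y z, ~ two_switch G w x y z) ->
    (forall x y z, ~ induced_3cycle G x y z) ->
  uniq [:: i; j; k] -> i < j -> arc G j k -> arc G i k.
Proof.
move=> lex no2 no3 /= uijk ltij Gjk; apply: contraT => Gik.
move: uijk; rewrite !inE !negb_or => /and3P[/andP[ij ik] jk _].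
have [ji ki kj] : [/\ j != i, k != i & k != j] by split; rewrite eq_sym.
have [] := positive_lex_lt lex ltij; rewrite !degree_seqE /= => out_le in_le.
(* Otherwise the arcs [(i, z)] and [(j, k)] form a 2-switch. *)
have subN z : z != j -> arc G i z -> arc G j z.
  move=> zj Giz; apply: contraT => Gjz; case: (no2 i z j k); split=> //=.
  have zi : z != i by apply: contraL Giz => /eqP->; rewrite arcxx.
  have zk : z != k by apply: contraL Giz => /eqP->.
  by rewrite !inE !negb_or ij ik zj zk jk (eq_sym i z) zi.
have outi : outdeg G i = arc G i j + #|[set w | arc G i w] :\ j|.
  by rewrite /outdeg (cardsD1 j) inE.
have outj : outdeg G j = arc G j i + (#|[set w | arc G j w] :\ i :\ k|).+1.
  by rewrite /outdeg (cardsD1 i) (cardsD1 k (_ :\ _)) !inE ki Gjk.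
have : [set w | arc G i w] :\ j \subset [set w | arc G j w] :\ i :\ k.
  apply/subsetP => z; rewrite !inE => /andP[zj Giz]; rewrite subN // andbT.
  by apply/andP; split; apply: contraL Giz => /eqP-> //; rewrite arcxx.
move=> /subset_leq_card le_out.
(* The arc [(j, k)] puts [j] one ahead of [i]; as [out_le] holds, only the arc [(i, j)] can make up
   for it. *)
have [Gij Gji out_eq] : [/\ arc G i j, ~~ arc G j i & outdeg G i = outdeg G j].
  by move: outi outj; case: (arc G i j); case: (arc G j i); split=> //; lia.
have ini : indeg G i = #|[set w | arc G w i] :\ j|.
  by rewrite /indeg (cardsD1 j) inE (negbTE Gji).
have inj : indeg G j = (#|[set w | arc G w j] :\ i|).+1.
  by rewrite /indeg (cardsD1 i) inE Gij.
(* Equal out-degrees make the order compare in-degrees. Since [j] receives an arc from [i] but sends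
   none back, [i] must have another in-neighbour [l] that [j] lacks. *)
have /subsetPn[l] : ~~ ([set w | arc G w i] :\ j \subset [set w | arc G w j] :\ i).
  apply/negP => /subset_leq_card; rewrite leqNgt.
  by have := in_le out_eq; rewrite ini inj => ->.
rewrite !inE => /andP[lj Gli].
have li : l != i by apply: contraL Gli => /eqP->; rewrite arcxx.
rewrite li /= => Glj.
(* If [l = k], then [i], [j], [k] form an induced 3-cycle. Otherwise there is a 2-switch: on
   [(l, i)] and [(j, k)] if [(l, k)] is not an arc, on [(l, k)] and [(i, j)] if it is. *)
have [eqlk|lk] := eqVneq l k.
  by case: (no3 i j k); rewrite -eqlk in Gjk Gik ik jk *; split=> //=;
    rewrite !inE !negb_or ij ik jk.
have Glk : arc G l k.
  apply: contraT => Glk; case: (no2 l i j k); split=> //=.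
  by rewrite !inE !negb_or li lj lk ij ik jk.
case: (no2 l k i j); split=> //=.
by rewrite !inE !negb_or li lj lk ij ki kj.
Qed.

(** * Counting in-neighbours in initial segments *)

Section PrefixCounts.
Variable n : nat.
Implicit Types G H : digraph n.

Definition in_prefix G (v : 'I_n) k := #|[set i : 'I_n | (i < k) && arc G i v]|.

(** Double counting of the arcs that leave the first [k] vertices, by tail and by head. *)
Lemma sum_outdeg_prefix G k :
  \sum_(i < n | i < k) outdeg G i = \sum_v in_prefix G v k.
Proof.
transitivity (\sum_(i < n | i < k) \sum_v (if arc G i v then 1 else 0)).
  by apply: eq_bigr => i _; rewrite /outdeg -sum1dep_card big_mkcond.
rewrite exchange_big; apply: eq_bigr => v _.
by rewrite /in_prefix -sum1dep_card big_mkcondr.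
Qed.

Lemma card_others_lt (v : 'I_n) k : k <= n ->
  #|[set i : 'I_n | (i < k) && (i != v)]| = k - (v < k).
Proof.
move=> lekn; have card_lt : #|[set i : 'I_n | i < k]| = k.
  rewrite -sum1dep_card -[RHS]card_ord -sum1_card.
  by rewrite (big_ord_widen _ (fun=> 1) lekn).
have -> : [set i : 'I_n | (i < k) && (i != v)] = [set i : 'I_n | i < k] :\ v.
  by apply/setP => i; rewrite !inE andbC.
by have := cardsD1 v [set i : 'I_n | i < k]; rewrite card_lt inE; lia.
Qed.

Lemma in_prefix_sub G v k :
  [set i : 'I_n | (i < k) && arc G i v] \subset
    [set i : 'I_n | (i < k) && (i != v)].
Proof.
apply/subsetP => i; rewrite !inE => /andP[-> Giv] /=.
by apply: contraL Giv => /eqP->; rewrite arcxx.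
Qed.

Lemma in_prefix_le G v k : k <= n ->
  in_prefix G v k <= minn (indeg G v) (k - (v < k)).
Proof.
move=> lekn; rewrite leq_min -(card_others_lt _ lekn).
rewrite (subset_leq_card (in_prefix_sub G v k)) andbT; apply: subset_leq_card.
by apply/subsetP => i; rewrite !inE => /andP[].
Qed.

Lemma in_prefix_column_monotone G v k : k <= n ->
    (forall i j : 'I_n, uniq [:: i; j; v] -> i < j -> arc G j v -> arc G i v) ->
  in_prefix G v k = minn (indeg G v) (k - (v < k)).
Proof.
move=> lekn mono; apply/eqP; rewrite eqn_leq in_prefix_le //=.
(* Either the prefix contains all in-neighbours of [v], or some in-neighbour lies beyond it and
   monotonicity makes the whole prefix, except [v], point to [v]. *)
have [/forallP in_lt|] := boolP [forall i, arc G i v ==> (i < k)].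
  apply: leq_trans (geq_minl _ _) (subset_leq_card _).
  apply/subsetP => i; rewrite !inE => Giv.
  by rewrite Giv andbT; exact: (implyP (in_lt i)).
rewrite negb_forall => /existsP[j]; rewrite negb_imply -leqNgt => /andP[Gjv lekj].
apply: leq_trans (geq_minr _ _) _; rewrite -(card_others_lt _ lekn).
apply/subset_leq_card/subsetP => i; rewrite !inE => /andP[ltik iv].
have ltij := leq_trans ltik lekj.
rewrite ltik (mono i j) //= !inE negb_or iv.
rewrite (_ : i != j); last by apply: contraTneq ltij => ->; rewrite ltnn.
by rewrite !andbT /=; apply: contraTneq Gjv => ->; rewrite arcxx.
Qed.

Lemma in_prefixS G (i v : 'I_n) : in_prefix G v i.+1 = arc G i v + in_prefix G v i.
Proof.
rewrite /in_prefix (cardsD1 i) inE ltnSn; congr (_ + _); apply: eq_card => j.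
by rewrite !inE ltnS andbA ltn_neqAle.
Qed.

(** Consecutive prefix counts differ by one matrix entry. *)
Lemma in_prefix_arcs G H :
  (forall v k, k <= n -> in_prefix H v k = in_prefix G v k) -> arcs H = arcs G.
Proof.
move=> eqHG; apply: arcs_eq => i v; have := eqHG v i.+1 (ltn_ord i).
rewrite !in_prefixS eqHG; last exact: ltnW.
by move=> /addIn; case: (arc H i v); case: (arc G i v).
Qed.

(** Merges the two sums of the fourth condition into one sum of the bounds of [in_prefix_le]. *)
Lemma sum_minn_prefix (d : 'I_n -> nat) k :
  \sum_(i < n | i < k) minn (d i) (k - 1) + \sum_(i < n | k <= i) minn (d i) k =
  \sum_i minn (d i) (k - (i < k)).
Proof.
rewrite [RHS](bigID (fun i : 'I_n => i < k)) /=; congr (_ + _).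
  by apply: eq_bigr => i ->.
by apply: eq_big => i; rewrite leqNgt // => /negbTE->; rewrite subn0.
Qed.

(** A sum of termwise inequalities that is an equality is one in each term. The resulting count
    depends on [alpha] alone, not on [H]. *)
Lemma in_prefix_realization (alpha : 'I_n -> nat * nat) H k :
    realization alpha H -> k <= n ->
    \sum_i minn (alpha i).2 (k - (i < k)) = \sum_(i < n | i < k) (alpha i).1 ->
  forall v, in_prefix H v k = minn (alpha v).2 (k - (v < k)).
Proof.
move=> rH lekn eq_sums v.
have le u : true -> in_prefix H u k <= minn (alpha u).2 (k - (u < k))
              ?= iff (in_prefix H u k == minn (alpha u).2 (k - (u < k))).
  by split=> //; rewrite -(proj2 (rH u)) in_prefix_le.
have [_] := leqif_sum le.
have -> : \sum_u in_prefix H u k = \sum_u minn (alpha u).2 (k - (u < k)).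
  rewrite eq_sums -sum_outdeg_prefix; apply: eq_bigr => i _.
  exact: (proj1 (rH i)).
by rewrite eqxx => /esym/forallP/(_ v)/eqP.
Qed.

End PrefixCounts.

Theorem theorem1 (n : nat) (G : digraph n)
    (hlex : positive_lex (degree_seq G)) :
  let A := adjmx G in
  let alpha := degree_seq G in
  [<-> unique_labeled_realization alpha G;
       (forall w x y z : 'I_n, ~ two_switch G w x y z) /\
       (forall x y z : 'I_n, ~ induced_3cycle G x y z);
       forall i j k : 'I_n, uniq [:: i; j; k] -> i < j ->
         A j k = 1 -> A i k = 1;
       forall k : nat, 1 <= k <= n ->
         \sum_(i < n | i < k) minn (alpha i).2 (k - 1) +
         \sum_(i < n | k <= i) minn (alpha i).2 k =
         \sum_(i < n | i < k) (alpha i).1].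
Proof.
move=> A alpha.
have AE i j : A i j = 1 <-> arc G i j by rewrite mxE; case: arc.
tfae.
- move=> uG; split=> [w x y z|x y z].
    exact: unique_realization_no_2switch.
  exact: unique_realization_no_3cycle.
- move=> [no2 no3] i j k uijk ltij /AE Gjk; apply/AE.
  exact: (switch_free_column_monotone hlex no2 no3 uijk).
- move=> mono k /andP[_ lekn]; rewrite sum_minn_prefix.
  transitivity (\sum_v in_prefix G v k).
    apply: eq_bigr => v _; rewrite /alpha degree_seqE in_prefix_column_monotone //.
    by move=> i j uijv ltij /AE Gjv; apply/AE/(mono i j).
  by rewrite -sum_outdeg_prefix; apply: eq_bigr => i _; rewrite /alpha degree_seqE.
move=> eq_sums; split=> [|H rH]; first exact: realization_degree_seq.
apply: in_prefix_arcs => v [_|k ltkn].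
  (* The hypothesis starts at [k = 1]; for [k = 0] both prefixes are empty. *)
  by rewrite /in_prefix !eq_card0 // => i; rewrite !inE.
have := eq_sums k.+1 ltkn; rewrite sum_minn_prefix => eq_k.
rewrite (in_prefix_realization rH ltkn eq_k).
by rewrite (in_prefix_realization (realization_degree_seq G) ltkn eq_k).
Qed.
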